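(* Let $G$ be a simple countable group admitting a compressible action by homeomorphisms on an infinite regular Hausdorff topological space $X$. Then $G$ has no proper characters; that is, every indecomposable character $\chi$ of $G$ is either the identity character ($\chi(g)=1$ for all $g\in G$) or the regular character ($\chi(e)=1$ and $\chi(g)=0$ for $g\ne e$).
   Context: A character of a group $G$ is a function $\chi:G\to\mathbb{C}$ such that (1) $\chi(g_1g_2)=\chi(g_2g_1)$ for all $g_1,g_2\in G$; (2) for every $n$ and $g_1,\dots,g_n\in G$ the matrix $\{\chi(g_ig_j^{-1})\}_{i,j=1}^n$ is nonnegative definite; (3) $\chi(e)=1$. A character $\chi$ is indecomposable if it cannot be written as $\chi=\alpha\chi_1+(1-\alpha)\chi_2$ with $0<\alpha<1$ and $\chi_1,\chi_2$ distinct characters. For a group $G$ acting on $X$ by homeomorphisms, $\mathrm{supp}(g)=\overline{\{x\in X: g(x)\ne x\}}$. The action is compressible if there exists a base $\mathfrak{U}$ of the topology of $X$ such that: (i) for every $g\in G$ there exists $U\in\mathfrak{U}$ with $\mathrm{supp}(g)\subset U$; (ii) for all $U_1,U_2\in\mathfrak{U}$ there exists $g\in G$ with $g(U_1)\subset U_2$; (iii) for all $U_1,U_2,U_3\in\mathfrak{U}$ with $\overline{U}_1\cap\overline{U}_2=\varnothing$ there exists $g\in G$ with $g(U_1)\cap U_3=\varnothing$ and $\mathrm{supp}(g)\cap U_2=\varnothing$; (iv) for all $U_1,U_2\in\mathfrak{U}$ there exists $U_3\in\mathfrak{U}$ with $U_3\supset U_1\cup U_2$. *)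

(* Defs.v *)
From mathcomp Require Import all_boot all_order all_algebra.
From mathcomp Require Import all_classical all_reals.
From mathcomp Require Import topology.
From mathcomp Require Import complex.

Set Implicit Arguments.
Unset Strict Implicit.
Unset Printing Implicit Defensive.

Import Order.TTheory GRing.Theory Num.Theory.
Local Open Scope classical_set_scope.
Local Open Scope ring_scope.
Local Open Scope complex_scope.

Definition normal_subgroup (G : groupType) (N : set G) : Prop :=
  [/\ N 1%g,
      forall g h, N g -> N h -> N (g * h)%g,
      forall g, N g -> N (g^-1)%g &
      forall g h, N g -> N (h * g * h^-1)%g].

Definition simple_group (G : groupType) : Prop :=
  (exists g : G, g <> 1%g) /\
  forall N : set G, normal_subgroup N -> N = [set 1%g] \/ N = [set: G].

Section Characters.
Context {R : realType}.
Local Notation C := R[i].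

(* The order of [R[i]] is partial: [0 <= z] says that [z] is real and
   nonnegative, so a nonnegative definite matrix is Hermitian. *)
Definition nonneg_definite (n : nat) (A : 'M[C]_n) : Prop :=
  forall c : 'I_n -> C, 0 <= \sum_(i < n) \sum_(j < n) (c i)^* * A i j * c j.

Context {G : groupType}.

Definition character (chi : G -> C) : Prop :=
  [/\ forall g h, chi (g * h)%g = chi (h * g)%g,
      forall (n : nat) (g : 'I_n -> G),
        nonneg_definite (\matrix_(i < n, j < n) chi (g i * (g j)^-1)%g) &
      chi 1%g = 1].

Definition indecomposable (chi : G -> C) : Prop :=
  character chi /\
  ~ exists (alpha : R) (chi1 chi2 : G -> C),
      [/\ 0 < alpha < 1, character chi1, character chi2, chi1 <> chi2 &
          forall g, chi g = alpha%:C * chi1 g + (1 - alpha)%:C * chi2 g].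

Definition identity_character (chi : G -> C) : Prop := forall g, chi g = 1.

Definition regular_character (chi : G -> C) : Prop :=
  chi 1%g = 1 /\ forall g, g <> 1%g -> chi g = 0.

End Characters.

Definition no_proper_characters (R : realType) (G : groupType) : Prop :=
  forall chi : G -> R[i],
    indecomposable chi -> identity_character chi \/ regular_character chi.

Definition homeomorphism (X Y : topologicalType) (f : X -> Y) : Prop :=
  continuous f /\
  exists f' : Y -> X, [/\ cancel f f', cancel f' f & continuous f'].

Record homeo_action (G : groupType) (X : topologicalType) := HomeoAction {
  hact :> G -> X -> X;
  hact1 : forall x, hact 1%g x = x;
  hactM : forall g h x, hact (g * h)%g x = hact g (hact h x);
  hact_homeo : forall g, homeomorphism (hact g)
}.

Section Compressible.
Context {G : groupType} {X : topologicalType} (a : homeo_action G X).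

Definition supp (g : G) : set X := closure [set x | a g x <> x].

Definition compressible : Prop :=
  exists U : set (set X), basis U /\
    [/\ forall g, exists2 U1, U U1 & supp g `<=` U1,
        forall U1 U2, U U1 -> U U2 -> exists g, a g @` U1 `<=` U2,
        forall U1 U2 U3, U U1 -> U U2 -> U U3 ->
          closure U1 `&` closure U2 = set0 ->
          exists g, a g @` U1 `&` U3 = set0 /\ supp g `&` U2 = set0 &
        forall U1 U2, U U1 -> U U2 ->
          exists2 U3, U U3 & U1 `|` U2 `<=` U3].

End Compressible.

(* Main.v *)
Require Import Defs.
From mathcomp Require Import all_boot all_order all_algebra.
From mathcomp Require Import all_classical all_reals.
From mathcomp Require Import topology.
From mathcomp Require Import complex ring.

Set Implicit Arguments.
Unset Strict Implicit.
Unset Printing Implicit Defensive.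

Import Order.TTheory GRing.Theory Num.Theory.
Local Open Scope classical_set_scope.
Local Open Scope ring_scope.

(** A character [chi] is a coefficient [g |-> <pi(g) v, v>] of a unitary
    representation [pi], and [chi (g * h^-1)] is the inner product of the unit
    vectors [pi(h)^-1 v] and [pi(g)^-1 v].  Positive definiteness, applied to
    well chosen coefficients, gives all the Hilbert space inequalities needed,
    so the representation itself never has to be built.

    Indecomposability is used once, to show that [chi] is multiplicative on
    elements with well separated supports ([character_separatedM]): if [g] and
    [k] are supported in members [U1] and [W] of the base with disjoint
    closures, then [chi (k * g) = chi k * chi g].  Fix [g].  Any [k] can be
    compressed into [W] by some conjugation, and pushing [g] far away, by an
    element that commutes with what lives in [W], shows that
    [phi k = chi (k^t * g)] does not depend on the compressing [t]
    ([twist_indep]).  A finite subset of the group can be compressed into [W]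
    all at once, where it commutes with [g]; inserting the positive element
    [4 + u^* g + u g^-1], for [u] on the unit circle, therefore gives a positive
    tracial function ([twisted_tracial_positive]).  The functions for [u] and
    [- u] add up to [8 chi], so by extremality each is a multiple of [chi].
    Taking [u = 1] and [u = 'i] isolates [phi k = chi k * chi g].

    Multiplicativity yields [|chi g| <= |chi h| ^ 2] for all [g <> 1] and all
    [h] ([character_domination]).  Choose [V] in the base so small that [V] and
    [g V] are well separated, and conjugates [l i] of [h] whose supports lie in
    well separated subsets of [V].  The conjugates [k i = l i * g * (l i)^-1]
    all have character value [chi g], whereas for [i <> j] the quotient
    [k i * (k j)^-1] is conjugate to [w * (g * w^-1 * g^-1)] with
    [w = (l j)^-1 * l i], of value [|chi w| ^ 2 = |chi h| ^ 4].  The average of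
    the first [n] vectors [pi(k i)^-1 v] has an inner product of modulus
    [|chi g|] with the unit vector [v], and its square norm tends to
    [|chi h| ^ 4]; Cauchy-Schwarz concludes.

    If [chi] does not vanish off [1], the inequality makes [chi h <> 0] for all
    [h], and with [g = h] it gives [|chi h| = 1] for all [h].  Then [chi] is a
    homomorphism to the circle whose kernel contains all commutators; as the
    group is simple and not commutative, [chi] is trivial. *)

(** * Inequalities for characters *)

Section CharacterInequalities.
Context {R : realType} {G : groupType}.
Local Notation C := R[i].
Implicit Types (chi : G -> C) (g h k : G).

Lemma characterJ chi g h : character chi -> chi (g * h * g^-1)%g = chi h.
Proof. by case=> chiC _ _; rewrite chiC monoid.mulKg. Qed.

Lemma character_psd chi (I : finType) (k : I -> G) (c : I -> C) :
  character chi ->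
  0 <= \sum_i \sum_j (c i)^* * c j * chi (k i * (k j)^-1)%g.
Proof.
have enumP := onW_bij predT (enum_val_bij I).
case=> _ psd _; rewrite (reindex _ enumP).
under eq_bigr => i _ do rewrite (reindex _ enumP).
have := psd #|I| (fun i => k (enum_val i)) (fun i => c (enum_val i)).
by under [X in _ <= X -> _]eq_bigr => i _ do
  under eq_bigr => j _ do rewrite mxE mulrAC.
Qed.

(** The Gram matrix of the three vectors attached to [1], [g] and [h].  The
    two-vector inequalities are the case [c = 0]. *)
Lemma character_psd3 chi g h (a b c : C) : character chi ->
  0 <= a^* * a + b^* * b + c^* * c
     + a^* * b * chi g^-1%g + b^* * a * chi g
     + a^* * c * chi h^-1%g + c^* * a * chi h
     + b^* * c * chi (g * h^-1)%g + c^* * b * chi (h * g^-1)%g.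
Proof.
move=> chiP; have [_ _ chi1] := chiP.
have := character_psd (tnth [tuple 1%g; g; h]) (tnth [tuple a; b; c]) chiP.
congr (0 <= _).
rewrite !big_ord_recl !big_ord0 !(tnth_nth 0) !(tnth_nth 1%g) /=.
rewrite !monoid.mul1g !monoid.invg1 !monoid.mulg1 !monoid.mulgV chi1.
ring.
Qed.

(** A nonnegative form is real, so the off-diagonal part of the Gram form of [1]
    and [g] is real for every coefficient; the coefficients [1] and ['i] together
    force the matrix to be Hermitian. *)
Lemma characterV chi g : character chi -> chi g^-1%g = (chi g)^*.
Proof.
move=> chiP.
have H b : b^* * chi g + b * chi g^-1%g \is Num.real.
  have := character_psd3 g 1%g 1 b 0 chiP.
  rewrite !conjC1 !conjC0 !(mul1r, mulr1, mul0r, mulr0, addr0) => /ger0_real Hr.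
  suff -> : b^* * chi g + b * chi g^-1%g
          = 1 + b^* * b + b * chi g^-1%g + b^* * chi g - (1 + b^* * b).
    by rewrite rpredB // rpredD ?rpred1 // ger0_real // mulrC mul_conjC_ge0.
  ring.
have /CrealP := H 1; have /CrealP := H 'i.
rewrite conjC1 conjCi !rmorphD !rmorphM /= !rmorphN /= !conjC1 conjCi.
set x := chi _; set y := chi _ => Hi H1.
have {}Hi : 'i * (x^* - y^*) = 'i * (y - x).
  have -> : 'i * (y - x) = - 'i * x + 'i * y by ring.
  by rewrite -Hi; ring.
have {}Hi := mulfI (neq0Ci _) Hi.
have : 2%:R * y = 2%:R * x^*.
  transitivity ((1 * x + 1 * y) + (y - x)); first by ring.
  by rewrite -Hi -H1; ring.
by apply: mulfI; rewrite pnatr_eq0.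
Qed.

(** Cauchy-Schwarz for the vectors attached to [1] and [g]. *)
Lemma character_le1 chi g : character chi -> `|chi g| <= 1.
Proof.
move=> chiP; have := character_psd3 g 1%g (- (chi g)^*) 1 0 chiP.
rewrite characterV // !conjC1 !conjC0 rmorphN /= conjCK.
have -> : forall z : C, - z * - z^* + 1 * 1 + 0 * 0 + - z * 1 * z^* +
      1 * - z^* * z + - z * 0 * chi 1^-1%g + 0 * - z^* * chi 1%g +
      1 * 0 * chi (g * 1^-1)%g + 0 * 1 * chi (1 * g^-1)%g = 1 - z * z^*.
  by move=> z; ring.
by rewrite subr_ge0 -normCK expr_le1.
Qed.

(** Equality in Cauchy-Schwarz makes the vectors attached to [1] and [g]
    proportional, so their inner products with the vector of [h^-1] are too. *)
Lemma character_unitM chi g h : character chi -> `|chi g| = 1 ->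
  chi (g * h)%g = chi g * chi h.
Proof.
move=> chiP u1.
have uu : chi g * (chi g)^* = 1 by rewrite -normCK u1 expr1n.
pose z := chi (g * h)%g - chi g * chi h.
suff : `|z| = 0 by move/normr0_eq0 /eqP; rewrite subr_eq0 => /eqP.
(* The first two coefficients give a null vector, of inner product [z] with the
   third one; the third coefficient makes the form equal to [- z * z^*]. *)
have := character_psd3 g h^-1%g (- (chi g)^*) 1 (- z^*) chiP.
have -> : chi (h^-1 * g^-1)%g = (chi (g * h)%g)^*.
  by rewrite -monoid.invgM characterV.
rewrite monoid.invgK !characterV // !conjC1 !rmorphN /= !conjCK.
have -> : - chi g * - (chi g)^* + 1 * 1 + - z * - z^*
     + - chi g * 1 * (chi g)^* + 1 * - (chi g)^* * chi g
     + - chi g * - z^* * chi h + - z * - (chi g)^* * (chi h)^*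
     + 1 * - z^* * chi (g * h)%g + - z * 1 * (chi (g * h)%g)^*
     = (1 - chi g * (chi g)^*) - z * z^*.
  by rewrite /z !rmorphB !rmorphM /=; ring.
rewrite uu subrr sub0r oppr_ge0 -normCK => H.
apply/eqP; rewrite -sqrf_eq0; apply/eqP/le_anti.
by rewrite H exprn_ge0.
Qed.

Lemma sum_bordered n (F : 'I_n.+1 -> 'I_n.+1 -> C) :
  \sum_i \sum_j F i j =
    F ord0 ord0 + \sum_j F ord0 (lift ord0 j) + \sum_i F (lift ord0 i) ord0
    + \sum_i \sum_j F (lift ord0 i) (lift ord0 j).
Proof.
rewrite big_ord_recl big_ord_recl -!addrA; congr (_ + (_ + _)).
by rewrite -big_split; apply: eq_bigr => i _; rewrite big_ord_recl.
Qed.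

(** Cauchy-Schwarz between the unit vector and the sum of the [n.+1] vectors
    attached to the [k i], whose Gram matrix has [1] on the diagonal and [q]
    elsewhere; a factor [n.+1] has been cancelled. *)
Lemma character_average_le chi n (k : 'I_n.+1 -> G) (c q : C) : character chi ->
  (forall i, chi (k i) = c) ->
  (forall i j, i != j -> chi (k i * (k j)^-1)%g = q) ->
  n.+1%:R * `|c| ^+ 2 <= 1 + n%:R * q.
Proof.
move=> chiP kc kq; have [_ _ chi1] := chiP.
pose k' i := if unlift ord0 i is Some j then k j else 1%g.
pose c' (i : 'I_n.+2) := if unlift ord0 i is Some j then 1 else - (n.+1%:R * c^*).
(* This coefficient of the unit vector minimizes the quadratic form. *)
have := character_psd k' c' chiP.
rewrite sum_bordered /k' /c' unlift_none.
under eq_bigr => j _ do rewrite liftK monoid.mul1g characterV // kc.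
under [X in _ + X + _]eq_bigr => i _ do
  rewrite liftK monoid.invg1 monoid.mulg1 kc.
under [X in _ + _ + _ + X]eq_bigr => i _.
  under eq_bigr => j _ do rewrite !liftK.
  rewrite (bigD1 i) //= monoid.mulgV chi1.
  under eq_bigr => j ji do rewrite kq 1?eq_sym //.
  rewrite sumr_const cardC1 card_ord.
  over.
rewrite !sumr_const card_ord monoid.invg1 monoid.mulg1 chi1 rmorphN rmorphM /=.
rewrite conjCK conjC1 rmorph_nat normCK.
(* As [n.+1%:R] is itself a multiple of [1], rewriting multiples into products
   only terminates once both numerals are opaque. *)
have [N NE] : exists N : C, N = n.+1%:R by eexists.
have [m mE] : exists m : C, m = n%:R by eexists.
have EN (x : C) : x *+ n.+1 = N * x by rewrite NE mulr_natl.
have Em (x : C) : x *+ n = m * x by rewrite mE mulr_natl.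
rewrite -NE -mE !EN !Em.
have -> : - (N * c) * - (N * c^*) * 1 + N * (- (N * c) * 1 * c^*) +
   N * (1 * - (N * c^*) * c) + (N * (1 * 1 * 1 + m * (1 * 1 * q)))
   = N * (1 + m * q - N * (c * c^*)) by ring.
by rewrite pmulr_rge0 ?subr_ge0 // NE ltr0Sn.
Qed.

Lemma archimedean_limit (a q : C) :
  a \is Num.real -> q \is Num.real ->
  (forall n, n.+1%:R * a <= 1 + n%:R * q) -> a <= q.
Proof.
move=> ar qr H; rewrite real_leNgt //; apply/negP => qa.
have d0 : 0 < a - q by rewrite subr_gt0.
have dr : a - q \is Num.real by rewrite gtr0_real.
have r0 : (0 : R) < complex.Re (a - q) by rewrite -ltcR RRe_real.
pose r := complex.Re (a - q).
pose n := Num.bound `|(1 - complex.Re q) / r|.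
have : ((1 - complex.Re q) / r) < n.+1%:R.
  apply: le_lt_trans (ler_norm _) (lt_trans (archi_boundP (normr_ge0 _)) _).
  by rewrite ltr_nat.
rewrite ltr_pdivrMr // -ltcR rmorphM rmorphB rmorph_nat rmorph1 /= !RRe_real //.
rewrite -subr_gt0.
have -> : n.+1%:R * (a - q) - (1 - q) = n.+1%:R * a - (1 + n%:R * q).
  by rewrite -natr1; ring.
by rewrite subr_gt0 => /lt_geF; rewrite H.
Qed.

End CharacterInequalities.

(** * Extremality *)

Section Convexity.
Context {R : realType} {G : groupType}.
Local Notation C := R[i].
Implicit Types (chi psi : G -> C).

(** Characters without the normalization, a convex cone in which
    indecomposable characters span extreme rays.  Positivity is written without
    matrices so that sums and multiples are immediate. *)
Definition tracial_positive psi : Prop :=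
  (forall g h, psi (g * h)%g = psi (h * g)%g) /\
  forall n (k : 'I_n -> G) (c : 'I_n -> C),
    0 <= \sum_(i < n) \sum_(j < n) (c i)^* * c j * psi (k i * (k j)^-1)%g.

Lemma tracial_positiveZ (r : C) psi : 0 <= r -> tracial_positive psi ->
  tracial_positive (fun g => r * psi g).
Proof.
move=> r0 [psiC psiP]; split=> [g h|n k c]; first by rewrite psiC.
under eq_bigr => i _ do under eq_bigr => j _ do rewrite mulrCA.
under eq_bigr => i _ do rewrite -mulr_sumr.
by rewrite -mulr_sumr mulr_ge0.
Qed.

Lemma normalized_character psi : tracial_positive psi -> 0 < psi 1%g ->
  character (fun g => (psi 1%g)^-1 * psi g).
Proof.
move=> psiP psi1; have [||psiC psiP'] := @tracial_positiveZ (psi 1%g)^-1 psi.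
- by rewrite invr_ge0 ltW.
- by [].
- split=> //; last by rewrite mulVf // gt_eqF.
  move=> n k c; have := psiP' n k c; congr (0 <= _).
  by apply: eq_bigr => i _; apply: eq_bigr => j _; rewrite mxE mulrAC.
Qed.

(** An indecomposable character spans an extreme ray: the weights of the two
    normalized summands are [psi1 1] and [psi2 1], both positive and of sum [1], so
    the normalized summands must coincide. *)
Lemma indecomposable_summand chi psi1 psi2 : indecomposable chi ->
  tracial_positive psi1 -> tracial_positive psi2 ->
  0 < psi1 1%g -> 0 < psi2 1%g -> (forall g, chi g = psi1 g + psi2 g) ->
  forall g, psi1 g = psi1 1%g * chi g.
Proof.
move=> [chiP indec] P1 P2 p1 p2 chiE.
have [_ _ chi1] := chiP.
pose chi1' g := (psi1 1%g)^-1 * psi1 g; pose chi2' g := (psi2 1%g)^-1 * psi2 g.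
have s1 : psi1 1%g + psi2 1%g = 1 by rewrite -chiE.
pose alpha := complex.Re (psi1 1%g).
have aE : (alpha%:C)%C = psi1 1%g by rewrite RRe_real // gtr0_real.
have bE : ((1 - alpha)%:C)%C = psi2 1%g.
  by rewrite rmorphB rmorph1 /= aE -s1 addrC addKr.
have chi12 : chi1' = chi2'.
  apply: contrapT => ne; apply: indec; exists alpha, chi1', chi2'; split=> //.
  - by rewrite -!ltcR aE rmorph0 rmorph1 p1 -s1 ltrDl.
  - exact: normalized_character.
  - exact: normalized_character.
  - by move=> g; rewrite aE bE /chi1' /chi2' !mulVKf ?gt_eqF.
move=> g; have -> : chi g = chi1' g.
  rewrite chiE -[psi1 g](mulVKf (lt0r_neq0 p1)) -[psi2 g](mulVKf (lt0r_neq0 p2)).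
  by rewrite -[_ * psi2 g]/(chi2' g) -chi12 -[_ * psi1 g]/(chi1' g) -mulrDl s1 mul1r.
by rewrite /chi1' mulVKf // gt_eqF.
Qed.

End Convexity.

(** * Supports and commutation *)

Section MovedPoints.
Context {G : groupType} {X : topologicalType} (a : homeo_action G X).

(** The support before taking the closure: its behaviour under products and
    conjugation involves no topology, and it is enough to detect commutation. *)
Definition moved (g : G) : set X := [set x | a g x <> x].

Lemma hactK g x : a g^-1%g (a g x) = x.
Proof. by rewrite -hactM monoid.mulVg hact1. Qed.

Lemma hactVK g x : a g (a g^-1%g x) = x.
Proof. by rewrite -hactM monoid.mulgV hact1. Qed.

Lemma moved_supp g : moved g `<=` supp a g.
Proof. exact: subset_closure. Qed.

Lemma moved1 : moved 1%g = set0.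
Proof. by rewrite -subset0 => x; rewrite /moved /= hact1. Qed.

Lemma movedV g : moved g^-1%g `<=` moved g.
Proof. by move=> x /= H gx; apply: H; rewrite -{1}gx hactK. Qed.

Lemma movedM g h (V : set X) :
  moved g `<=` V -> moved h `<=` V -> moved (g * h)%g `<=` V.
Proof.
move=> gV hV x; rewrite {1}/moved /= hactM => ghx.
have [hx|hx] := pselect (a h x = x); last exact: hV.
by apply: gV => /= gx; apply: ghx; rewrite hx.
Qed.

Lemma moved_conj t g (U V : set X) :
  moved g `<=` U -> a t @` U `<=` V -> moved (t * g * t^-1)%g `<=` V.
Proof.
move=> gU tU x /= H; apply: tU; exists (a t^-1%g x); last exact: hactVK.
by apply: gU => /= K; apply: H; rewrite !hactM K hactVK.
Qed.

Hypothesis faithful : forall g, moved g = set0 -> g = 1%g.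

Lemma hact_inj g h : a g =1 a h -> g = h.
Proof.
move=> gh; apply: (monoid.mulgI h^-1%g); rewrite monoid.mulVg.
by apply: faithful; rewrite -subset0 => x; rewrite /moved /= hactM gh hactK.
Qed.

Lemma moved_commute g h : moved g `&` moved h = set0 -> (g * h = h * g)%g.
Proof.
move=> gh0; apply: hact_inj => x; rewrite !hactM.
have inj k : injective (a k) by exact: can_inj (hactK k).
have nh y : moved g y -> a h y = y.
  by move=> gy; apply: contrapT => hy; rewrite -[False]/(set0 y) -gh0.
have ng y : moved h y -> a g y = y.
  by move=> hy; apply: contrapT => gy; rewrite -[False]/(set0 y) -gh0.
have [gx|gx] := pselect (a g x = x).
  have [hx|hx] := pselect (a h x = x); first by rewrite gx hx gx.
  by rewrite gx ng // => /inj.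
by rewrite (nh x) // nh // => /inj.
Qed.

End MovedPoints.

(** * Separation by members of the base *)

Lemma infinite_two_points (T : Type) : infinite_set [set: T] ->
  exists x y : T, x <> y.
Proof.
move=> infT; apply: contrapT => no2; apply: infT.
have [[x _]|T0] := pselect ([set: T] !=set0).
  apply: sub_finite_set (finite_set1 x) => y _ /=.
  by apply: contrapT => xy; apply: no2; exists y, x.
suff -> : [set: T] = set0 by exact: finite_set0.
by rewrite -subset0 => y _; apply: T0; exists y.
Qed.

(** The Hausdorff property separates the points by open sets, and regularity
    shrinks these so that even the closures are disjoint. *)
Lemma basis_separated (X : topologicalType) (U : set (set X)) (x y : X)
    (A B : set X) : regular_space X -> hausdorff_space X -> basis U ->
  x <> y -> nbhs x A -> nbhs y B ->
  exists V W, [/\ U V /\ V x, U W /\ W y, V `<=` A, W `<=` B &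
    closure V `&` closure W = set0].
Proof.
move=> reg; rewrite open_hausdorff => haus [_ bas] /eqP xy xA yB.
have [[A' B'] /= [xA' yB'] [oA' oB' /eqP AB']] := haus _ _ xy.
have pick z (D E : set X) : nbhs z D -> open E -> z \in E ->
    exists V, [/\ U V, V z, V `<=` D & closure V `<=` E].
  move=> zD oE zE; have nE : nbhs z E.
    by apply: open_nbhs_nbhs; split=> //; rewrite inE in zE.
  have [M zM ME] := reg z _ nE.
  have [V [UV Vz] VMD] := bas z _ (filterI zM zD).
  exists V; split=> // [t /VMD[]//|]; apply: subset_trans ME.
  by apply: closureS => t /VMD[].
have [V [UV Vx VA VA']] := pick _ _ _ xA oA' xA'.
have [W [UW Wy WB WB']] := pick _ _ _ yB oB' yB'.
by exists V, W; split=> //; exact: subsetI_eq0 AB'.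
Qed.

(** * Multiplicativity on separated elements *)

Section Compressibility.
Context {R : realType} {G : groupType} {X : topologicalType}.
Context (a : homeo_action G X) (U : set (set X)).
Local Notation C := R[i].
Local Notation moved := (moved a).

Hypothesis faithful : forall g, moved g = set0 -> g = 1%g.
Hypothesis moved_in : forall g, exists2 U1, U U1 & moved g `<=` U1.
Hypothesis compress :
  forall U1 U2, U U1 -> U U2 -> exists g, a g @` U1 `<=` U2.
Hypothesis push : forall U1 U2 U3, U U1 -> U U2 -> U U3 ->
  closure U1 `&` closure U2 = set0 ->
  exists g, a g @` U1 `&` U3 = set0 /\ moved g `&` U2 = set0.
Hypothesis directed : forall U1 U2, U U1 -> U U2 ->
  exists2 U3, U U3 & U1 `|` U2 `<=` U3.

Lemma common_support (s : seq G) :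
  exists2 U1, U U1 & forall g, g \in s -> moved g `<=` U1.
Proof.
elim: s => [|g s [U1 UU1 sU1]].
  by have [U1 ? _] := moved_in 1%g; exists U1.
have [U2 UU2 gU2] := moved_in g.
have [U3 UU3 U123] := directed UU1 UU2; exists U3 => // h.
rewrite inE => /predU1P[->|/sU1 hU1] x hx; apply: U123; [right|left].
  exact: gU2.
exact: hU1.
Qed.

(** Positive definiteness involves finitely many elements at a time; this
    compresses all of them by the same conjugation. *)
Lemma common_compression W (s : seq G) : U W ->
  exists t, forall g, g \in s -> moved (t * g * t^-1)%g `<=` W.
Proof.
move=> UW; have [U1 UU1 sU1] := common_support s.
have [t tW] := compress UU1 UW; exists t => g /sU1 gU1.
exact: moved_conj tW.
Qed.

Section Twist.
Context (chi : G -> C) (U1 W : set X).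
Hypotheses (chiP : indecomposable chi) (UU1 : U U1) (UW : U W).
Hypothesis U1W : closure U1 `&` closure W = set0.

Let chiC : forall g h, chi (g * h)%g = chi (h * g)%g.
Proof. by case: chiP => -[]. Qed.

Lemma separated_commute g k : moved g `<=` U1 -> moved k `<=` W ->
  (g * k = k * g)%g.
Proof.
move=> gU kW; apply: (moved_commute faithful).
apply: (subsetI_eq0 _ _ U1W); [apply: subset_trans gU _|apply: subset_trans kW _];
  exact: subset_closure.
Qed.

(** Push [g] by some [s] so far that it commutes with [r], where [s] is taken to
    commute with everything supported in [W].  Then conjugating by [s], by [r]
    and by [s^-1] leads from [l * g] to [r * l * r^-1 * g]. *)
Lemma twist_indep g l r : moved g `<=` U1 ->
  moved l `<=` W -> moved (r * l * r^-1)%g `<=` W ->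
  chi (r * l * r^-1 * g)%g = chi (l * g)%g.
Proof.
move=> gU lW rlW; have [U3 UU3 rU3] := moved_in r.
have [s [sU1 sW]] := push UU1 UW UU3 U1W.
have away k : moved k `<=` W -> chi (k * (s * g * s^-1))%g = chi (k * g)%g.
  move=> kW; have sk : (s * k = k * s)%g.
    by apply: (moved_commute faithful); exact: (subsetI_eq0 _ kW sW).
  by rewrite -[RHS](characterJ s _ chiP.1) !monoid.mulgA -sk.
rewrite -away // -[RHS]away // -[RHS](characterJ r _ chiP.1).
have /esym rg : (r^-1 * (s * g * s^-1) = (s * g * s^-1) * r^-1)%g.
  apply: (moved_commute faithful); rewrite setIC.
  apply: (subsetI_eq0 _ _ sU1); first exact: moved_conj gU _.
  by apply: subset_trans rU3; exact: movedV.
by move: (s * g * s^-1)%g rg => x rg; rewrite -!monoid.mulgA rg.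
Qed.

(** [phi k] and [phi' k] stand for [chi (k^t * g)] and [chi (k^t * g^-1)], with
    [k^t] any conjugate of [k] supported in [W].  In the group algebra
    [4 + u^* g + u g^-1 = 2 + (1 + u^* g) (1 + u^* g)^*], and for finitely many
    [k] a single [t] makes all the [k^t] commute with [g]; positivity follows
    from that of [chi]. *)
Lemma twisted_tracial_positive g (phi phi' : G -> C) (u : C) :
  moved g `<=` U1 -> u^* * u = 1 ->
  (forall k t, moved (t * k * t^-1)%g `<=` W ->
     phi k = chi (t * k * t^-1 * g)%g /\ phi' k = chi (t * k * t^-1 * g^-1)%g) ->
  tracial_positive (fun k => 4%:R * chi k + (u^* * phi k + u * phi' k)).
Proof.
move=> gU uu phiE.
have gV : moved g^-1%g `<=` U1 by apply: subset_trans gU; exact: movedV.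
split=> [k l | n k c].
  have [t tW] := common_compression [:: k; l] UW.
  have {tW} [kW lW] : moved (t * k * t^-1)%g `<=` W /\ moved (t * l * t^-1)%g `<=` W.
    by split; apply: tW; rewrite !inE eqxx ?orbT.
  have tJ x y : (t * (x * y) * t^-1 = (t * x * t^-1) * (t * y * t^-1))%g.
    by rewrite !monoid.mulgA monoid.mulgVK.
  have [-> ->] : phi (k * l)%g = chi ((t * k * t^-1) * (t * l * t^-1) * g)%g /\
      phi' (k * l)%g = chi ((t * k * t^-1) * (t * l * t^-1) * g^-1)%g.
    by rewrite -tJ; apply: phiE; rewrite tJ; exact: movedM.
  have [-> ->] : phi (l * k)%g = chi ((t * l * t^-1) * (t * k * t^-1) * g)%g /\
      phi' (l * k)%g = chi ((t * l * t^-1) * (t * k * t^-1) * g^-1)%g.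
    by rewrite -tJ; apply: phiE; rewrite tJ; exact: movedM.
  have swap x : moved x `<=` U1 -> chi (t * k * t^-1 * (t * l * t^-1) * x)%g =
      chi (t * l * t^-1 * (t * k * t^-1) * x)%g.
    move=> xU; rewrite -monoid.mulgA chiC -!(monoid.mulgA (t * l * t^-1)%g).
    by rewrite (separated_commute xU kW).
  by rewrite chiC !swap.
have [t tW] := common_compression (codom k) UW.
have [l ldef] : exists l : 'I_n -> G, forall i, l i = (t * k i * t^-1)%g.
  by exists (fun i => t * k i * t^-1)%g.
have lW i : moved (l i) `<=` W by rewrite ldef; apply: tW; exact: codom_f.
have lE i j : (t * (k i * (k j)^-1) * t^-1 = l i * (l j)^-1)%g.
  by rewrite !ldef !monoid.invgM monoid.invgK !monoid.mulgA monoid.mulgVK.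
have chiE i j : chi (k i * (k j)^-1)%g = chi (l i * (l j)^-1)%g.
  by rewrite -lE characterJ //; case: chiP.
have phisE i j : phi (k i * (k j)^-1)%g = chi (l i * g * (l j)^-1)%g /\
    phi' (k i * (k j)^-1)%g = chi (l i * g^-1 * (l j)^-1)%g.
  have lV : moved (l j)^-1%g `<=` W by apply: subset_trans (lW j); exact: movedV.
  have [] := phiE (k i * (k j)^-1)%g t.
    by rewrite lE; exact: movedM.
  rewrite lE -!monoid.mulgA => -> ->.
  by rewrite -(separated_commute gU lV) -(separated_commute gV lV).
(* The family [l i], [l i * g] realizes the factor [1 + u^* g]; the family [l i],
   used twice, realizes the summand [2]. *)
have := character_psd (fun z : 'I_n + 'I_n =>
    match z with inl i => l i | inr i => (l i * g)%g end)
  (fun z => match z with inl i => c i | inr i => u * c i end) chiP.1.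
have := character_psd l c chiP.1.
rewrite big_sumType /=.
under [X in _ -> 0 <= X + _ -> _]eq_bigr => i _ do rewrite big_sumType /= -big_split.
under [X in _ -> 0 <= _ + X -> _]eq_bigr => i _ do rewrite big_sumType /= -big_split.
rewrite -big_split /= => H1 H2.
have H := addr_ge0 (addr_ge0 H1 H1) H2; move: H.
rewrite -!big_split /=; congr (0 <= _).
apply: eq_bigr => i _; rewrite -!big_split /=; apply: eq_bigr => j _.
have [-> ->] := phisE i j; rewrite chiE !rmorphM /=.
have -> : (l i * g * (l j * g)^-1 = l i * (l j)^-1)%g.
  by rewrite monoid.invgM monoid.mulgA monoid.mulgK.
rewrite monoid.invgM monoid.mulgA; set x := chi _; set y := chi _; set z := chi _.
transitivity ((c i)^* * c j * ((3%:R + u^* * u) * x + (u^* * z + u * y))).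
  by ring.
by rewrite uu; ring.
Qed.

(** The positive functions [psi u] and [psi (- u)] add up to [8 chi], so each is
    a multiple of [chi]; the summand [4] keeps [psi u 1] positive.  The values
    [1] and ['i] of [u] then separate the contributions of [g] and [g^-1]. *)
Lemma character_separatedM g k : moved g `<=` U1 -> moved k `<=` W ->
  chi (k * g)%g = chi k * chi g.
Proof.
move=> gU kW; have [chiQ _] := chiP; have [_ _ chi1] := chiQ.
have gV : moved g^-1%g `<=` U1 by apply: subset_trans gU; exact: movedV.
have ex x : exists t, moved (t * x * t^-1)%g `<=` W.
  have [t tW] := common_compression [:: x] UW; exists t.
  by apply: tW; rewrite inE eqxx.
have [T TW] := choice ex.
pose phi y x := chi (T x * x * (T x)^-1 * y)%g.
have phiE y x t : moved y `<=` U1 -> moved (t * x * t^-1)%g `<=` W ->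
    phi y x = chi (t * x * t^-1 * y)%g.
  move=> yU xW; rewrite /phi -(@twist_indep y _ (t * (T x)^-1)%g) //.
    by rewrite monoid.invgM monoid.invgK !monoid.mulgA !monoid.mulgVK.
  by rewrite monoid.invgM monoid.invgK !monoid.mulgA !monoid.mulgVK.
have phi1 y : moved y `<=` U1 -> phi y 1%g = chi y.
  move=> yU; rewrite (phiE _ _ 1%g) // ?monoid.mul1g ?monoid.invg1 ?monoid.mul1g //.
  by rewrite moved1; exact: sub0set.
pose psi u x := 4%:R * chi x + (u^* * phi g x + u * phi g^-1%g x).
have psiP u : u^* * u = 1 -> tracial_positive (fun x => 8%:R^-1 * psi u x).
  move=> uu; apply: tracial_positiveZ; first by rewrite invr_ge0.
  by apply: (twisted_tracial_positive gU uu) => x t xW; split; exact: phiE.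
have psi1 u : psi u 1%g = 4%:R + (u^* * chi g + u * (chi g)^*).
  by rewrite /psi !phi1 // chi1 characterV // mulr1.
have psi1_gt0 u : u^* * u = 1 -> 0 < 8%:R^-1 * psi u 1%g.
  move=> uu; have u1 : `|u| = 1.
    by apply/eqP; rewrite -sqrp_eq1 // normCKC uu.
  rewrite mulr_gt0 ?invr_gt0 // psi1; set s := _ + u * _.
  have sr : s \is Num.real.
    by apply/CrealP; rewrite /s rmorphD !rmorphM /= !conjCK addrC.
  have : `|s| <= 2%:R.
    apply: le_trans (ler_normD _ _) _.
    by rewrite !normrM !norm_conjC u1 !mul1r lerD // character_le1.
  rewrite -normrN => s2; rewrite -[s]opprK subr_gt0.
  have : - s <= `|- s| by rewrite real_ler_norm // rpredN.
  by move/le_trans/(_ s2)/le_lt_trans; apply; rewrite ltr_nat.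
have key u : u^* * u = 1 -> u^* * chi (k * g)%g + u * chi (k * g^-1)%g =
    (u^* * chi g + u * (chi g)^*) * chi k.
  move=> uu; have uuN : (- u)^* * - u = 1 by rewrite rmorphN mulrNN.
  have psiE x : chi x = 8%:R^-1 * psi u x + 8%:R^-1 * psi (- u) x.
    rewrite /psi rmorphN /=; apply: (@mulfI _ 8%:R); first by rewrite pnatr_eq0.
    rewrite mulrDr !mulVKf ?pnatr_eq0 //; ring.
  have := indecomposable_summand chiP (psiP u uu) (psiP _ uuN) (psi1_gt0 u uu)
    (psi1_gt0 _ uuN) psiE k.
  rewrite -mulrA => /mulfI; rewrite invr_eq0 pnatr_eq0 => /(_ isT).
  rewrite psi1 /psi !(phiE _ k 1%g) // ?monoid.mul1g ?monoid.invg1 ?monoid.mulg1 //.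
  by rewrite [X in _ = X -> _]mulrDl; apply: addrI.
have := key 'i; have := key 1.
rewrite conjC1 conjCi !mul1r mulNr -expr2 sqrCi opprK => /(_ erefl) e1 /(_ erefl) ei.
have {}ei : chi (k * g)%g - chi (k * g^-1)%g = (chi g - (chi g)^*) * chi k.
  apply: (@mulfI _ (- 'i : C)); first by rewrite oppr_eq0 neq0Ci.
  transitivity (- 'i * chi (k * g)%g + 'i * chi (k * g^-1)%g); first by ring.
  by rewrite ei; ring.
apply: (@mulfI _ (2%:R : C)); first by rewrite pnatr_eq0.
transitivity ((chi (k * g)%g + chi (k * g^-1)%g) + (chi (k * g)%g - chi (k * g^-1)%g)).
  by ring.
by rewrite e1 ei; ring.
Qed.

End Twist.

(** * Domination of character values *)

Hypotheses (infX : infinite_set [set: X]) (regX : regular_space X).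
Hypotheses (hausX : hausdorff_space X) (basU : basis U).

Lemma exists_disjoint_pair :
  exists V W, [/\ U V, U W, V !=set0 & closure V `&` closure W = set0].
Proof.
have [x [y xy]] := infinite_two_points infX.
have [V [W [[? Vx] [? _] _ _ ?]]] := basis_separated regX hausX basU xy
  (@filterT _ _ _) (@filterT _ _ _).
by exists V, W; split=> //; exists x.
Qed.

(** Two points of the space lie in a common member of the base, which can be
    compressed into [V]; hence [V] has two points, and these can be separated. *)
Lemma exists_disjoint_pair_in V : U V -> exists V1 V2,
  [/\ U V1, U V2, V1 `<=` V, V2 `<=` V & closure V1 `&` closure V2 = set0].
Proof.
move=> UV; have [x [y xy]] := infinite_two_points infX.
have [A [B [[UA Ax] [UB By] _ _ _]]] := basis_separated regX hausX basU xy
  (@filterT _ _ _) (@filterT _ _ _).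
have [D UD ABD] := directed UA UB.
have [t tD] := compress UD UV.
have Vx : nbhs (a t x) V.
  apply: open_nbhs_nbhs; split; first exact: basU.1.
  by apply: tD; exists x => //; apply: ABD; left.
have Vy : nbhs (a t y) V.
  apply: open_nbhs_nbhs; split; first exact: basU.1.
  by apply: tD; exists y => //; apply: ABD; right.
have txy : a t x <> a t y by move=> /(congr1 (a t^-1%g)); rewrite !hactK.
have [V1 [V2 [[? _] [? _] ? ? ?]]] := basis_separated regX hausX basU txy Vx Vy.
by exists V1, V2.
Qed.

(** Iterate [exists_disjoint_pair_in], keeping the first part as the next [W i]
    and splitting the second part further. *)
Lemma exists_disjoint_sequence V : U V -> exists W : nat -> set X,
  (forall i, U (W i) /\ W i `<=` V) /\
  (forall i j, i != j -> closure (W i) `&` closure (W j) = set0).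
Proof.
move=> UV.
have split_ex (D : set X) : exists p : set X * set X, U D ->
    [/\ U p.1, U p.2, p.1 `<=` D, p.2 `<=` D & closure p.1 `&` closure p.2 = set0].
  have [UD|nUD] := pselect (U D); last by exists (D, D).
  by have [V1 [V2 H]] := exists_disjoint_pair_in UD; exists (V1, V2).
have [S SP] := choice split_ex.
pose D i := iter i (fun D => (S D).2) V.
have UD i : U (D i) by elim: i => //= i /SP[].
have DD i j : D (i + j)%N `<=` D i.
  elim: j => [|j IH]; first by rewrite addn0.
  by rewrite addnS; apply: subset_trans IH; have [] := SP _ (UD (i + j)%N).
have sep i j : (i < j)%N -> closure (S (D i)).1 `&` closure (S (D j)).1 = set0.
  move=> ij; have [_ _ _ _ H] := SP _ (UD i).
  apply: (subsetI_eq0 _ _ H) => //; apply: closureS.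
  have [_ _ sub _ _] := SP _ (UD j); apply: subset_trans sub _.
  by rewrite -(subnKC ij); exact: (DD i.+1).
exists (fun i => (S (D i)).1); split=> [i|i j].
  have [? _ sub _ _] := SP _ (UD i); split=> //.
  by apply: subset_trans sub _; exact: (DD 0).
by rewrite neq_ltn => /orP[|] /sep //; rewrite setIC.
Qed.

(** Otherwise [g] equals two of its conjugates, compressed into disjoint sets. *)
Lemma exists_noncommuting g : g <> 1%g -> exists t : G, (t * g * t^-1)%g <> g.
Proof.
move=> g1; have [V [W [UV UW _ VW]]] := exists_disjoint_pair.
have conj_in D : U D -> exists t, moved (t * g * t^-1)%g `<=` D.
  move=> UD; have [t tD] := common_compression [:: g] UD.
  by exists t; apply: tD; rewrite inE eqxx.
have [t tV] := conj_in _ UV; have [s sW] := conj_in _ UW.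
apply: contrapT => all_eq; apply: g1; apply: faithful.
have fix_g r : (r * g * r^-1)%g = g.
  by apply: contrapT => rg; apply: all_eq; exists r.
rewrite fix_g in tV; rewrite fix_g in sW.
rewrite -[moved g]setIid; apply: (subsetI_eq0 _ _ VW).
  by apply: subset_trans tV _; exact: subset_closure.
by apply: subset_trans sW _; exact: subset_closure.
Qed.

Lemma exists_separated_translate g : g <> 1%g -> exists V W1 W2,
  [/\ U V, U W1 /\ U W2, V `<=` W1, a g @` V `<=` W2 &
    closure W1 `&` closure W2 = set0].
Proof.
move=> g1; have [x gx] : exists x, moved g x.
  apply: contrapT => no; apply: g1; apply: faithful.
  by rewrite -subset0 => x gx; apply: no; exists x.
have [W1 [W2 [[UW1 W1x] [UW2 W2gx] _ _ W12]]] := basis_separated regX hausX basU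
  (nesym gx) (@filterT _ _ _) (@filterT _ _ _).
have nx : nbhs x (W1 `&` a g @^-1` W2).
  apply: filterI; first by apply: open_nbhs_nbhs; split=> //; exact: basU.1.
  have [gcont _] := hact_homeo a g; apply: gcont.
  by apply: open_nbhs_nbhs; split=> //; exact: basU.1.
have [V [UV Vx] VW] := basU.2 x _ nx.
exists V, W1, W2; split=> //; first by move=> y /VW[].
by move=> _ [y /VW[_ ?] <-].
Qed.

(** The vectors attached to the conjugates [l i * g * (l i)^-1] have the constant
    inner product [|chi h| ^ 4] with each other: their quotients are conjugate to
    commutators [w * (g * w^-1 * g^-1)] with [w] supported in [V], which are
    products of two elements with separated supports. *)
Lemma character_domination (chi : G -> C) g h : indecomposable chi ->
  g <> 1%g -> `|chi g| <= `|chi h| ^+ 2.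
Proof.
move=> chiP g1; have chiQ := chiP.1.
have mulchi := character_separatedM chiP.
have [V [W1 [W2 [UV [UW1 UW2] VW1 gVW2 W12]]]] := exists_separated_translate g1.
have [W [WV Wdisj]] := exists_disjoint_sequence UV.
have conj_in i : exists t, moved (t * h * t^-1)%g `<=` W i.
  have [t tD] := common_compression [:: h] (WV i).1.
  by exists t; apply: tD; rewrite inE eqxx.
have [t tW] := choice conj_in.
have [l [lW lchi]] : exists l : nat -> G, (forall i, moved (l i) `<=` W i) /\
    forall i, chi (l i) = chi h.
  by exists (fun i => t i * h * (t i)^-1)%g; split=> // i; exact: characterJ.
have lV i : moved (l i)^-1%g `<=` W i.
  by apply: subset_trans (lW i); exact: movedV.
have chiw i j : i != j -> chi ((l j)^-1 * l i)%g = `|chi h| ^+ 2.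
  move=> ij; rewrite (mulchi _ _ (WV i).1 (WV j).1 (Wdisj _ _ ij)) //.
  by rewrite characterV // !lchi normCKC.
rewrite -(@ler_pXn2r _ 2) ?nnegrE ?exprn_ge0 //.
apply: archimedean_limit => [||n]; rewrite ?rpredX ?normr_real //.
apply: (character_average_le (k := fun i : 'I_n.+1 => (l i * g * (l i)^-1)%g) chiQ).
  by move=> i; rewrite characterJ.
move=> i j ij.
pose w := ((l j)^-1 * l i)%g.
have wV : moved w `<=` V.
  by apply: movedM; [apply: subset_trans (lV j) _|apply: subset_trans (lW i) _];
    exact: (WV _).2.
have wV' : moved w^-1%g `<=` V by apply: subset_trans wV; exact: movedV.
have -> : (l i * g * (l i)^-1 * (l j * g * (l j)^-1)^-1 =
    l j * (w * (g * w^-1 * g^-1)) * (l j)^-1)%g.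
  rewrite /w !monoid.invgM !monoid.invgK !monoid.mulgA.
  by rewrite monoid.mulgV monoid.mul1g.
rewrite characterJ // (mulchi _ _ UW2 UW1); first last.
- exact: subset_trans VW1.
- exact: moved_conj gVW2.
- by rewrite setIC.
by rewrite characterJ // characterV // -normCK /w chiw // normrX normr_id.
Qed.

End Compressibility.

(** * Characters of modulus one *)

Section UnimodularCharacter.
Context {R : realType} {G : groupType}.
Variable (chi : G -> R[i]).
Hypotheses (chiP : character chi) (chi_unit : forall g, `|chi g| = 1).

Lemma unimodular_kernel_normal : normal_subgroup [set g | chi g = 1].
Proof.
have [_ _ chi1] := chiP; split=> [//|g h /= cg ch|g /= cg|g h /= cg].
- by rewrite character_unitM // cg ch mulr1.
- by rewrite characterV // cg conjC1.
- by rewrite characterJ.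
Qed.

Lemma unimodular_commutator g t : chi (t * g * t^-1 * g^-1)%g = 1.
Proof.
by rewrite character_unitM // characterJ // characterV // -normCK chi_unit expr1n.
Qed.

End UnimodularCharacter.

Theorem theorem2p9 (R : realType) (G : groupType) (X : topologicalType)
    (a : homeo_action G X) :
  simple_group G -> countable [set: G] ->
  infinite_set [set: X] -> regular_space X -> hausdorff_space X ->
  compressible a ->
  no_proper_characters R G.
Proof.
move=> [[g0 g0N1] simG] _ infX regX hausX [U [basU [supp_in compress push directed]]].
have moved_in g : exists2 U1, U U1 & moved a g `<=` U1.
  have [U1 UU1 gU1] := supp_in g; exists U1 => //.
  by apply: subset_trans gU1; exact: moved_supp.
have {}push U1 U2 U3 : U U1 -> U U2 -> U U3 -> closure U1 `&` closure U2 = set0 ->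
    exists g, a g @` U1 `&` U3 = set0 /\ moved a g `&` U2 = set0.
  move=> UU1 UU2 UU3 /(push _ _ _ UU1 UU2 UU3)[g [gU1 gU2]]; exists g; split=> //.
  by apply: (subsetI_eq0 _ _ gU2) => //; exact: moved_supp.
(* The action is faithful: a simple group acting with a kernel acts trivially,
   and then no member of the base could be compressed into a disjoint one. *)
have kerN : normal_subgroup [set g | moved a g = set0].
  split=> /= [|g h gE hE|g gE|g h gE]; rewrite -subset0.
  - by rewrite moved1.
  - by apply: movedM; rewrite ?gE ?hE.
  - by rewrite -gE; exact: movedV.
  - by apply: (@moved_conj _ _ _ _ _ set0); rewrite ?gE ?image_set0.
have faithful g : moved a g = set0 -> g = 1%g.
  have [kerE|kerE] := simG _ kerN.
    by move=> gker; have : [set g | moved a g = set0] g by []; rewrite kerE.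
  have [V [W [UV UW [x Vx] VW]]] := exists_disjoint_pair infX regX hausX basU.
  have [t tVW] := compress _ _ UV UW.
  have tx : a t x = x.
    apply: contrapT => tx; have : [set g | moved a g = set0] t by rewrite kerE.
    by move=> /= t0; rewrite -[False]/(set0 x) -t0.
  exfalso; rewrite -[False]/(set0 x) -VW; split; apply: subset_closure => //.
  by apply: tVW; exists x.
move=> chi chiP; have [chiC _ chi1] := chiP.1.
have dom g h : g <> 1%g -> `|chi g| <= `|chi h| ^+ 2.
  exact: (character_domination faithful moved_in compress push directed).
have [chi0|] := pselect (forall g, g <> 1%g -> chi g = 0); first by right.
move=> /existsNP[g /not_implyP[g1 /eqP cg]]; left.
(* [dom g h] shows that [chi h] is nonzero, and then [dom h h] that its modulus
   is at least [1]. *)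
have chi_unit h : `|chi h| = 1.
  have [->|/eqP h1] := eqVneq h 1%g; first by rewrite chi1 normr1.
  apply/le_anti; rewrite character_le1 //=; last exact: chiP.1.
  have ch : 0 < `|chi h|.
    rewrite normr_gt0; apply/eqP => ch.
    have := dom g h g1; rewrite ch normr0 expr0n /= ; apply/negP.
    by rewrite normr_le0.
  by have := dom h h h1; rewrite expr2 -[X in X <= _]mulr1 ler_pM2l.
have [kerE|kerE] := simG _ (unimodular_kernel_normal chiP.1 chi_unit); last first.
  by move=> h; have : [set g | chi g = 1] h by rewrite kerE.
(* Were the kernel trivial, the group would embed into the circle and be
   commutative. *)
have [t []] := exists_noncommuting faithful moved_in compress directed infX regX
  hausX basU g0N1.
apply/monoid.divg1_eq.
have : [set g | chi g = 1] (t * g0 * t^-1 * g0^-1)%g.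
  exact: unimodular_commutator chiP.1 chi_unit _ _.
by rewrite kerE.
Qed.
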